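(* Let $(\mathcal C,\otimes,I,\gamma)$ be a symmetric monoidal category, $\mathcal T$ a strong monad on it, and $\mathcal S$ a strong submonad of $\mathcal T$ with strong submonad monomorphism $\iota:\mathcal S\Rightarrow\mathcal T$. The following are equivalent: (1) for every object $X$ of $\mathcal C$, $(\mathcal SX,\iota_X)$ is a central cone for $\mathcal T$ at $X$; (2) the canonical embedding functor $\mathcal I:\mathcal C_{\mathcal S}\to\mathcal C_{\mathcal T}$ corestricts to an embedding of categories $\hat{\mathcal I}:\mathcal C_{\mathcal S}\to Z(\mathcal C_{\mathcal T})$. Furthermore, these conditions imply that $\mathcal S$ is a commutative submonad of $\mathcal T$. Under the additional assumption that $\mathcal T$ is centralisable, these conditions are also equivalent to: (3) $\mathcal S$ is a submonad of the centre $\mathcal Z$ of $\mathcal T$ (and thus is commutative), i.e. $\iota=\iota^{\mathcal Z}\circ j$ for some strong submonad monomorphism $j:\mathcal S\Rightarrow\mathcal Z$, where $\iota^{\mathcal Z}:\mathcal Z\Rightarrow\mathcal T$ is the submonad monomorphism of the centre.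
   Context: $\mathcal T=(\mathcal T,\eta,\mu,\tau)$ with left strength $\tau_{X,Y}:X\otimes\mathcal TY\to\mathcal T(X\otimes Y)$, right strength $\tau'_{X,Y}=\mathcal T(\gamma_{Y,X})\circ\tau_{Y,X}\circ\gamma_{\mathcal TX,Y}$; commutative means $\mu\circ\mathcal T\tau'\circ\tau=\mu\circ\mathcal T\tau\circ\tau'$. A morphism of strong monads $\iota:\mathcal S\Rightarrow\mathcal T$ is a natural transformation with $\iota\circ\eta^{\mathcal S}=\eta^{\mathcal T}$, $\iota\circ\mu^{\mathcal S}=\mu^{\mathcal T}\circ\mathcal T\iota\circ\iota_{\mathcal S}$, $\iota\circ\tau^{\mathcal S}_{X,Y}=\tau^{\mathcal T}_{X,Y}\circ(X\otimes\iota_Y)$; a strong submonad is one where $\iota$ is a monomorphism in the category of strong monads. A central cone of $\mathcal T$ at $X$ is $(W,\kappa)$, $\kappa:W\to\mathcal TX$, with $\mu\circ\mathcal T\tau'_{X,Y}\circ\tau_{\mathcal TX,Y}\circ(\kappa\otimes\mathcal TY)=\mu\circ\mathcal T\tau_{X,Y}\circ\tau'_{X,\mathcal TY}\circ(\kappa\otimes\mathcal TY)$ for all $Y$; $\mathcal T$ is centralisable if every $X$ has a terminal central cone $(\mathcal ZX,\iota^{\mathcal Z}_X)$ (terminal w.r.t. morphisms $\varphi$ with $\kappa\circ\varphi=\kappa'$); then $X\mapsto\mathcal ZX$ extends to a commutative strong monad $\mathcal Z$ with $\iota^{\mathcal Z}$ a strong submonad monomorphism, called the centre of $\mathcal T$.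 Kleisli category $\mathcal C_{\mathcal T}$: morphisms $X\to\mathcal TY$, composition $g\odot f=\mu\circ\mathcal Tg\circ f$; $\mathcal I$ is identity on objects and $f\mapsto\iota_Y\circ f$. For $f:Y\to\mathcal TZ$, $f\otimes_l X=\tau'_{Z,X}\circ(f\otimes X)$ and $X\otimes_r f=\tau_{X,Z}\circ(X\otimes f)$; $f:X\to\mathcal TY$ is central if $(f\otimes_l Y')\odot(X\otimes_r f')=(Y\otimes_r f')\odot(f\otimes_l X')$ for all $f':X'\to\mathcal TY'$; $Z(\mathcal C_{\mathcal T})$ is the subcategory of all objects and central morphisms.
   Formalization: The equivalence of (1) and (2) and the commutativity of S assume explicitly that the canonical functor I is an embedding (faithful), which does not follow from ι being monic among strong monads; (1) iff I corestricts to a functor, and (1) iff (3), need no such assumption. *)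

(* Defs.v *)
From Stdlib Require Import ssreflect FunctionalExtensionality ProofIrrelevance.

Set Implicit Arguments.
Unset Strict Implicit.
Unset Printing Implicit Defensive.

Declare Scope cat_scope.
Delimit Scope cat_scope with cat.
Local Open Scope cat_scope.

Reserved Notation "g ∘ f" (at level 40, left associativity).
Reserved Notation "X ⊗ Y" (at level 39, left associativity).
Reserved Notation "f ⊗₁ g" (at level 39, left associativity).

Record category := Category {
  ob :> Type;
  hom : ob -> ob -> Type;
  idm : forall X, hom X X;
  comp : forall X Y Z, hom Y Z -> hom X Y -> hom X Z;
  compA : forall X Y Z W (h : hom Z W) (g : hom Y Z) (f : hom X Y),
    comp h (comp g f) = comp (comp h g) f;
  comp1f : forall X Y (f : hom X Y), comp (idm Y) f = f;
  compf1 : forall X Y (f : hom X Y), comp f (idm X) = f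
}.
Arguments hom {c} X Y : rename.
Arguments idm {c} X : rename.
Notation "g ∘ f" := (comp g f) : cat_scope.

Definition monic (C : category) (X Y : C) (m : hom X Y) : Prop :=
  forall (W : C) (f g : hom W X), m ∘ f = m ∘ g -> f = g.

Record functor (C D : category) := Functor {
  fob :> C -> D;
  fmap : forall X Y, hom X Y -> hom (fob X) (fob Y);
  fmap1 : forall X, fmap (idm X) = idm (fob X);
  fmapD : forall X Y Z (g : hom Y Z) (f : hom X Y),
    fmap (g ∘ f) = fmap g ∘ fmap f
}.
Arguments fmap {C D} f {X Y} _ : rename.

Lemma functor_comp1 (C D E : category) (G : functor D E) (F : functor C D) X :
  fmap G (fmap F (idm X)) = idm (G (F X)).
Proof. by rewrite !fmap1. Qed.

Lemma functor_compD (C D E : category) (G : functor D E) (F : functor C D)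
    X Y Z (g : hom Y Z) (f : hom X Y) :
  fmap G (fmap F (g ∘ f)) = fmap G (fmap F g) ∘ fmap G (fmap F f).
Proof. by rewrite !fmapD. Qed.

Definition functor_comp (C D E : category) (G : functor D E) (F : functor C D) :
  functor C E :=
  {| fob := fun X => G (F X);
     fmap := fun X Y f => fmap G (fmap F f);
     fmap1 := functor_comp1 G F;
     fmapD := functor_compD G F |}.

Definition is_embedding (C D : category) (F : functor C D) : Prop :=
  (forall X Y : C, F X = F Y -> X = Y) /\
  (forall (X Y : C) (f g : hom X Y), fmap F f = fmap F g -> f = g).

Record symmonoidal := SymMonoidal {
  smc_cat :> category;
  unit_ob : smc_cat;
  tens : smc_cat -> smc_cat -> smc_cat;
  tensm : forall X X' Y Y' : smc_cat,
    hom X X' -> hom Y Y' -> hom (tens X Y) (tens X' Y');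
  tensm1 : forall X Y, tensm (idm X) (idm Y) = idm (tens X Y);
  tensmD : forall X X' X'' Y Y' Y''
    (f' : hom X' X'') (f : hom X X') (g' : hom Y' Y'') (g : hom Y Y'),
    tensm (f' ∘ f) (g' ∘ g) = tensm f' g' ∘ tensm f g;
  assoc : forall X Y Z, hom (tens (tens X Y) Z) (tens X (tens Y Z));
  assocV : forall X Y Z, hom (tens X (tens Y Z)) (tens (tens X Y) Z);
  assocK : forall X Y Z, assocV X Y Z ∘ assoc X Y Z = idm _;
  assocVK : forall X Y Z, assoc X Y Z ∘ assocV X Y Z = idm _;
  assoc_nat : forall X X' Y Y' Z Z' (f : hom X X') (g : hom Y Y') (h : hom Z Z'),
    assoc X' Y' Z' ∘ tensm (tensm f g) h = tensm f (tensm g h) ∘ assoc X Y Z;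
  lunit : forall X, hom (tens unit_ob X) X;
  lunitV : forall X, hom X (tens unit_ob X);
  lunitK : forall X, lunitV X ∘ lunit X = idm _;
  lunitVK : forall X, lunit X ∘ lunitV X = idm _;
  lunit_nat : forall X X' (f : hom X X'),
    lunit X' ∘ tensm (idm unit_ob) f = f ∘ lunit X;
  runit : forall X, hom (tens X unit_ob) X;
  runitV : forall X, hom X (tens X unit_ob);
  runitK : forall X, runitV X ∘ runit X = idm _;
  runitVK : forall X, runit X ∘ runitV X = idm _;
  runit_nat : forall X X' (f : hom X X'),
    runit X' ∘ tensm f (idm unit_ob) = f ∘ runit X;
  symm : forall X Y, hom (tens X Y) (tens Y X);
  symm_nat : forall X X' Y Y' (f : hom X X') (g : hom Y Y'),
    symm X' Y' ∘ tensm f g = tensm g f ∘ symm X Y;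
  symmK : forall X Y, symm Y X ∘ symm X Y = idm _;
  triangle : forall X Y,
    tensm (idm X) (lunit Y) ∘ assoc X unit_ob Y = tensm (runit X) (idm Y);
  pentagon : forall X Y Z W,
    assoc X Y (tens Z W) ∘ assoc (tens X Y) Z W =
    tensm (idm X) (assoc Y Z W) ∘ assoc X (tens Y Z) W
      ∘ tensm (assoc X Y Z) (idm W);
  hexagon : forall X Y Z,
    assoc Y Z X ∘ symm X (tens Y Z) ∘ assoc X Y Z =
    tensm (idm Y) (symm X Z) ∘ assoc Y X Z ∘ tensm (symm X Y) (idm Z)
}.
Arguments unit_ob {s} : rename.
Arguments assoc {s} X Y Z : rename.
Arguments assocV {s} X Y Z : rename.
Arguments lunit {s} X : rename.
Arguments lunitV {s} X : rename.
Arguments runit {s} X : rename.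
Arguments runitV {s} X : rename.
Arguments symm {s} X Y : rename.
Notation "X ⊗ Y" := (tens X Y) : cat_scope.
Notation "f ⊗₁ g" := (tensm f g) : cat_scope.

Record strong_monad (C : symmonoidal) := StrongMonad {
  sm_fun :> functor C C;
  eta : forall X, hom X (sm_fun X);
  mu : forall X, hom (sm_fun (sm_fun X)) (sm_fun X);
  tau : forall X Y, hom (X ⊗ sm_fun Y) (sm_fun (X ⊗ Y));
  eta_nat : forall X Y (f : hom X Y), eta Y ∘ f = fmap sm_fun f ∘ eta X;
  mu_nat : forall X Y (f : hom X Y),
    mu Y ∘ fmap sm_fun (fmap sm_fun f) = fmap sm_fun f ∘ mu X;
  mu_etaT : forall X, mu X ∘ eta (sm_fun X) = idm _;
  mu_Teta : forall X, mu X ∘ fmap sm_fun (eta X) = idm _;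
  mu_mu : forall X, mu X ∘ mu (sm_fun X) = mu X ∘ fmap sm_fun (mu X);
  tau_nat : forall X X' Y Y' (f : hom X X') (g : hom Y Y'),
    tau X' Y' ∘ (f ⊗₁ fmap sm_fun g) = fmap sm_fun (f ⊗₁ g) ∘ tau X Y;
  tau_lunit : forall X, fmap sm_fun (lunit X) ∘ tau unit_ob X = lunit (sm_fun X);
  tau_assoc : forall X Y Z,
    fmap sm_fun (assoc X Y Z) ∘ tau (X ⊗ Y) Z =
    tau X (Y ⊗ Z) ∘ (idm X ⊗₁ tau Y Z) ∘ assoc X Y (sm_fun Z);
  tau_eta : forall X Y, tau X Y ∘ (idm X ⊗₁ eta Y) = eta (X ⊗ Y);
  tau_mu : forall X Y,
    tau X Y ∘ (idm X ⊗₁ mu Y) = mu (X ⊗ Y) ∘ fmap sm_fun (tau X Y) ∘ tau X (sm_fun Y)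
}.
Arguments eta {C} s X : rename.
Arguments mu {C} s X : rename.
Arguments tau {C} s X Y : rename.

Definition tau' (C : symmonoidal) (T : strong_monad C) (X Y : C) :
  hom (T X ⊗ Y) (T (X ⊗ Y)) :=
  fmap T (symm Y X) ∘ tau T Y X ∘ symm (T X) Y.
Arguments tau' {C} T X Y.

Definition dst (C : symmonoidal) (T : strong_monad C) (X Y : C) :
  hom (T X ⊗ T Y) (T (X ⊗ Y)) :=
  mu T (X ⊗ Y) ∘ fmap T (tau' T X Y) ∘ tau T (T X) Y.
Arguments dst {C} T X Y.

Definition dst' (C : symmonoidal) (T : strong_monad C) (X Y : C) :
  hom (T X ⊗ T Y) (T (X ⊗ Y)) :=
  mu T (X ⊗ Y) ∘ fmap T (tau T X Y) ∘ tau' T X (T Y).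
Arguments dst' {C} T X Y.

Definition commutative (C : symmonoidal) (T : strong_monad C) : Prop :=
  forall X Y : C, dst T X Y = dst' T X Y.

Record strong_monad_hom (C : symmonoidal) (S T : strong_monad C) :=
  StrongMonadHom {
  smh :> forall X, hom (S X) (T X);
  smh_nat : forall X Y (f : hom X Y), smh Y ∘ fmap S f = fmap T f ∘ smh X;
  smh_eta : forall X, smh X ∘ eta S X = eta T X;
  smh_mu : forall X, smh X ∘ mu S X = mu T X ∘ fmap T (smh X) ∘ smh (S X);
  smh_tau : forall X Y, smh (X ⊗ Y) ∘ tau S X Y = tau T X Y ∘ (idm X ⊗₁ smh Y)
}.

Lemma strong_monad_hom_eq (C : symmonoidal) (S T : strong_monad C)
    (f g : strong_monad_hom S T) : (forall X, f X = g X) -> f = g.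
Proof.
case: f g => [f f1 f2 f3 f4] [g g1 g2 g3 g4] /= fg.
have e : f = g by apply: functional_extensionality_dep.
by case: _ / e in g1 g2 g3 g4 fg *; f_equal; apply: proof_irrelevance.
Qed.

(* Reassociation of commuting squares and triangles, for use under a tail. *)
Lemma rew21 (C : category) (X Y Z W : C) (a : hom Y Z) (b : hom X Y) (c : hom X Z)
  (k : hom W X) : a ∘ b = c -> a ∘ (b ∘ k) = c ∘ k.
Proof. by move=> <-; rewrite compA. Qed.

Lemma rew22 (C : category) (X Y Y' Z W : C) (a : hom Y Z) (b : hom X Y)
  (c : hom Y' Z) (d : hom X Y') (k : hom W X) :
  a ∘ b = c ∘ d -> a ∘ (b ∘ k) = c ∘ (d ∘ k).
Proof. by move=> e; rewrite !compA e. Qed.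

Lemma rew23 (C : category) (X Y Y1 Y2 Z W : C) (a : hom Y Z) (b : hom X Y)
  (c : hom Y2 Z) (d : hom Y1 Y2) (e : hom X Y1) (k : hom W X) :
  a ∘ b = c ∘ d ∘ e -> a ∘ (b ∘ k) = c ∘ (d ∘ (e ∘ k)).
Proof. by move=> E; rewrite !compA E. Qed.

Lemma rew20 (C : category) (X Y W : C) (a : hom Y X) (b : hom X Y) (k : hom W X) :
  a ∘ b = idm X -> a ∘ (b ∘ k) = k.
Proof. by move=> e; rewrite compA e comp1f. Qed.

Lemma tensmDl (C : symmonoidal) (X Y Y' Y'' : C) (g' : hom Y' Y'') (g : hom Y Y') :
  idm X ⊗₁ (g' ∘ g) = (idm X ⊗₁ g') ∘ (idm X ⊗₁ g).
Proof. by rewrite -tensmD comp1f. Qed.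

Lemma tensmDr (C : symmonoidal) (X X' X'' Y : C) (f' : hom X' X'') (f : hom X X') :
  (f' ∘ f) ⊗₁ idm Y = (f' ⊗₁ idm Y) ∘ (f ⊗₁ idm Y).
Proof. by rewrite -tensmD comp1f. Qed.

Lemma strong_monad_id_mu (C : symmonoidal) (T : strong_monad C) X :
  idm (T X) ∘ mu T X = mu T X ∘ fmap T (idm (T X)) ∘ idm (T (T X)).
Proof. by rewrite fmap1 !compf1 comp1f. Qed.

Lemma strong_monad_id_tau (C : symmonoidal) (T : strong_monad C) X Y :
  idm (T (X ⊗ Y)) ∘ tau T X Y = tau T X Y ∘ (idm X ⊗₁ idm (T Y)).
Proof. by rewrite tensm1 compf1 comp1f. Qed.

Lemma strong_monad_id_nat (C : symmonoidal) (T : strong_monad C) X Y (f : hom X Y) :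
  idm (T Y) ∘ fmap T f = fmap T f ∘ idm (T X).
Proof. by rewrite compf1 comp1f. Qed.

Definition strong_monad_id (C : symmonoidal) (T : strong_monad C) :
  strong_monad_hom T T :=
  {| smh := fun X => idm (T X);
     smh_nat := @strong_monad_id_nat C T;
     smh_eta := fun X => comp1f (eta T X);
     smh_mu := @strong_monad_id_mu C T;
     smh_tau := @strong_monad_id_tau C T |}.

Definition strong_monad_comp (C : symmonoidal) (R S T : strong_monad C)
    (g : strong_monad_hom S T) (f : strong_monad_hom R S) : strong_monad_hom R T.
Proof.
exists (fun X => g X ∘ f X).
- by move=> X Y h; rewrite -compA smh_nat compA smh_nat compA.
- by move=> X; rewrite -compA !smh_eta.
- move=> X; rewrite -!compA (smh_mu f) -!compA (rew23 _ (smh_mu g X)) fmapD -!compA.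
  by rewrite (rew22 _ (smh_nat g (f X))).
- by move=> X Y; rewrite -compA smh_tau compA smh_tau -compA tensmDl.
Defined.

Definition StrMnd (C : symmonoidal) : category.
Proof.
refine {| ob := strong_monad C;
          hom := @strong_monad_hom C;
          idm := @strong_monad_id C;
          comp := @strong_monad_comp C |}.
- by move=> *; apply: strong_monad_hom_eq => X; apply: compA.
- by move=> *; apply: strong_monad_hom_eq => X; apply: comp1f.
- by move=> *; apply: strong_monad_hom_eq => X; apply: compf1.
Defined.

(* Monomorphism in [StrMnd C]: when [C] lacks kernel pairs the components of such
   an [iota] need not be monic in [C]. *)
Definition is_strong_submonad (C : symmonoidal) (S T : strong_monad C)
    (iota : strong_monad_hom S T) : Prop :=
  @monic (StrMnd C) S T iota.

Definition kcomp (C : symmonoidal) (T : strong_monad C) (X Y Z : C)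
    (g : hom Y (T Z)) (f : hom X (T Y)) : hom X (T Z) :=
  mu T Z ∘ fmap T g ∘ f.

Definition kleisli (C : symmonoidal) (T : strong_monad C) : category.
Proof.
refine {| ob := ob C;
          hom := fun X Y => hom X (T Y);
          idm := eta T;
          comp := @kcomp C T |}.
- rewrite /kcomp => X Y Z W h g f; rewrite !fmapD -!compA.
  by rewrite (rew22 _ (eq_sym (mu_nat T h))) (rew22 _ (mu_mu T W)).
- by rewrite /kcomp => X Y f; rewrite mu_Teta comp1f.
- by rewrite /kcomp => X Y f; rewrite -compA -eta_nat compA mu_etaT comp1f.
Defined.

Definition kleisli_functor (C : symmonoidal) (S T : strong_monad C)
    (iota : strong_monad_hom S T) : functor (kleisli S) (kleisli T).
Proof.
refine {| fob := fun X : kleisli S => X : kleisli T;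
          fmap := fun (X Y : C) (f : hom X (S Y)) => iota Y ∘ f |}.
- by move=> X; apply: smh_eta.
- move=> X Y Z g f; rewrite /= /kcomp -!compA fmapD (rew23 _ (smh_mu iota Z)) -!compA.
  by rewrite (rew22 _ (smh_nat iota g)).
Defined.

(* [f ⊗_l X] and [X ⊗_r f]. *)
Definition tensl (C : symmonoidal) (T : strong_monad C) (Y Z : C)
    (f : hom Y (T Z)) (X : C) : hom (Y ⊗ X) (T (Z ⊗ X)) :=
  tau' T Z X ∘ (f ⊗₁ idm X).

Definition tensr (C : symmonoidal) (T : strong_monad C) (X Y Z : C)
    (f : hom Y (T Z)) : hom (X ⊗ Y) (T (X ⊗ Z)) :=
  tau T X Z ∘ (idm X ⊗₁ f).
Arguments tensr {C} T X {Y Z} f.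

Definition central (C : symmonoidal) (T : strong_monad C) (X Y : C)
    (f : hom X (T Y)) : Prop :=
  forall (X' Y' : C) (f' : hom X' (T Y')),
    kcomp (tensl f Y') (tensr T X f') = kcomp (tensr T Y f') (tensl f X').

Lemma tau'_nat (C : symmonoidal) (T : strong_monad C) (X X' Y Y' : C)
    (f : hom X X') (g : hom Y Y') :
  tau' T X' Y' ∘ (fmap T f ⊗₁ g) = fmap T (f ⊗₁ g) ∘ tau' T X Y.
Proof.
rewrite /tau' -!compA symm_nat (rew22 _ (tau_nat T g f)).
by rewrite !compA -!fmapD symm_nat.
Qed.

Lemma tau'_eta (C : symmonoidal) (T : strong_monad C) (X Y : C) :
  tau' T X Y ∘ (eta T X ⊗₁ idm Y) = eta T (X ⊗ Y).
Proof.
by rewrite /tau' -!compA symm_nat (rew21 _ (tau_eta T Y X)) eta_nat compA -fmapD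
  symmK fmap1 comp1f.
Qed.

Lemma tau'_mu (C : symmonoidal) (T : strong_monad C) (X Y : C) :
  tau' T X Y ∘ (mu T X ⊗₁ idm Y) =
  mu T (X ⊗ Y) ∘ fmap T (tau' T X Y) ∘ tau' T (T X) Y.
Proof.
rewrite /tau' -!compA symm_nat (rew23 _ (tau_mu T Y X)) (rew22 _ (eq_sym (mu_nat T _))).
rewrite !fmapD -!compA; do 3 congr (_ ∘ _).
by rewrite (rew20 (a := fmap T _)) // -fmapD symmK fmap1.
Qed.

Lemma tau'E (C : symmonoidal) (T : strong_monad C) (X Y : C) :
  tau' T X Y = fmap T (symm Y X) ∘ tau T Y X ∘ symm (T X) Y.
Proof. by []. Qed.

(* Unlike [rewrite -!compA], this does not unfold defined composites. *)
Ltac rassoc := repeat rewrite <- compA.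

Definition is_central_cone (C : symmonoidal) (T : strong_monad C) (X W : C)
    (kappa : hom W (T X)) : Prop :=
  forall Y : C,
    dst T X Y ∘ (kappa ⊗₁ idm (T Y)) = dst' T X Y ∘ (kappa ⊗₁ idm (T Y)).

Lemma kcomp_tensl_tensr (C : symmonoidal) (T : strong_monad C) (X Y X' Y' : C)
    (f : hom X (T Y)) (f' : hom X' (T Y')) :
  kcomp (tensl f Y') (tensr T X f') =
  dst T Y Y' ∘ (f ⊗₁ idm (T Y')) ∘ (idm X ⊗₁ f').
Proof.
rewrite /kcomp /tensl /tensr /dst 2!fmapD; rassoc.
by rewrite (rew22 _ (eq_sym (tau_nat T f (idm Y')))) fmap1.
Qed.

Lemma kcomp_tensr_tensl (C : symmonoidal) (T : strong_monad C) (X Y X' Y' : C)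
    (f : hom X (T Y)) (f' : hom X' (T Y')) :
  kcomp (tensr T Y f') (tensl f X') =
  dst' T Y Y' ∘ (f ⊗₁ idm (T Y')) ∘ (idm X ⊗₁ f').
Proof.
rewrite /kcomp /tensl /tensr /dst' !fmapD; rassoc.
rewrite (rew22 _ (eq_sym (tau'_nat T (idm Y) f'))) fmap1.
by rewrite -!tensmD !comp1f !compf1.
Qed.

Lemma central_coneP (C : symmonoidal) (T : strong_monad C) (X Y : C)
    (f : hom X (T Y)) : central f <-> is_central_cone f.
Proof.
split=> [cf Y'|cf X' Y' f'].
  move: (cf _ _ (idm (T Y'))); rewrite kcomp_tensl_tensr kcomp_tensr_tensl.
  by rewrite tensm1 !compf1.
by rewrite kcomp_tensl_tensr kcomp_tensr_tensl cf.
Qed.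

Lemma kcompA (C : symmonoidal) (T : strong_monad C) (X Y Z W : C)
    (h : hom Z (T W)) (g : hom Y (T Z)) (f : hom X (T Y)) :
  kcomp h (kcomp g f) = kcomp (kcomp h g) f.
Proof. exact: (@compA (kleisli T)). Qed.

Lemma tenslD (C : symmonoidal) (T : strong_monad C) (X Y Z X' : C)
    (g : hom Y (T Z)) (f : hom X (T Y)) :
  tensl (kcomp g f) X' = kcomp (tensl g X') (tensl f X').
Proof.
rewrite /kcomp /tensl !tensmDr fmapD; rassoc; rewrite (rew23 _ (tau'_mu T Z X')).
by rewrite (rew22 _ (tau'_nat T g (idm X'))).
Qed.

Lemma central_kcomp (C : symmonoidal) (T : strong_monad C) (X Y Z : C)
    (g : hom Y (T Z)) (f : hom X (T Y)) :
  central g -> central f -> central (kcomp g f).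
Proof.
by move=> cg cf X' Y' f'; rewrite !tenslD -kcompA cf kcompA cg kcompA.
Qed.

Lemma central_eta (C : symmonoidal) (T : strong_monad C) (X : C) :
  central (eta T X).
Proof.
move=> X' Y' f'; rewrite /tensl !tau'_eta /kcomp mu_Teta comp1f -!compA.
by rewrite -eta_nat compA mu_etaT comp1f.
Qed.

Definition kleisli_centre (C : symmonoidal) (T : strong_monad C) : category.
Proof.
refine {| ob := ob C;
          hom := fun X Y => {f : hom X (T Y) | central f};
          idm := fun X => exist _ (eta T X) (@central_eta C T X);
          comp := fun X Y Z g f =>
            exist _ (kcomp (proj1_sig g) (proj1_sig f))
              (central_kcomp (proj2_sig g) (proj2_sig f)) |}.
- by move=> X Y Z W h g f; apply: subset_eq_compat; apply: kcompA.
- move=> X Y [f cf]; apply: subset_eq_compat; exact: (@comp1f (kleisli T)).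
- move=> X Y [f cf]; apply: subset_eq_compat; exact: (@compf1 (kleisli T)).
Defined.

Definition kleisli_centre_incl (C : symmonoidal) (T : strong_monad C) :
  functor (kleisli_centre T) (kleisli T) :=
  {| fob := fun X : kleisli_centre T => X : kleisli T;
     fmap := fun X Y (f : @hom (kleisli_centre T) X Y) => proj1_sig f;
     fmap1 := fun X => eq_refl;
     fmapD := fun X Y Z g f => eq_refl |}.

Definition corestricts_to (C : symmonoidal) (S T : strong_monad C)
    (iota : strong_monad_hom S T)
    (Ihat : functor (kleisli S) (kleisli_centre T)) : Prop :=
  functor_comp (kleisli_centre_incl T) Ihat = kleisli_functor iota.

Record central_cone (C : symmonoidal) (T : strong_monad C) (X : C) := CentralCone {
  apex : C;
  leg : hom apex (T X);
  legP : is_central_cone leg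
}.

Record terminal_central_cone (C : symmonoidal) (T : strong_monad C) (X : C) :=
  TerminalCentralCone {
  tcc_cone :> central_cone T X;
  tcc_map : forall c : central_cone T X, hom (apex c) (apex tcc_cone);
  tcc_mapE : forall c, leg tcc_cone ∘ tcc_map c = leg c;
  tcc_uniq : forall c (phi : hom (apex c) (apex tcc_cone)),
    leg tcc_cone ∘ phi = leg c -> phi = tcc_map c
}.

(* [Type]-valued: a choice of terminal central cones is part of the data. *)
Definition centralisable (C : symmonoidal) (T : strong_monad C) : Type :=
  forall X : C, terminal_central_cone T X.

Lemma central_cone_pre (C : symmonoidal) (T : strong_monad C) (X W W' : C)
    (k : hom W (T X)) (h : hom W' W) :
  is_central_cone k -> is_central_cone (k ∘ h).
Proof. by move=> ck Y; rewrite tensmDr !compA ck. Qed.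

Lemma tcc_monic (C : symmonoidal) (T : strong_monad C) (X : C)
    (c : terminal_central_cone T X) : monic (leg c).
Proof.
move=> W f g fg.
have cf : is_central_cone (leg c ∘ f) by apply/central_cone_pre/legP.
rewrite (tcc_uniq (c := CentralCone cf) (phi := f)) //.
by rewrite (tcc_uniq (c := CentralCone cf) (phi := g)).
Qed.

Lemma central_cone_kcomp (C : symmonoidal) (T : strong_monad C) (X Y Z : C)
    (g : hom Y (T Z)) (f : hom X (T Y)) :
  is_central_cone g -> is_central_cone f ->
  is_central_cone (mu T Z ∘ fmap T g ∘ f).
Proof.
by move=> /central_coneP cg /central_coneP cf; apply/central_coneP/central_kcomp.
Qed.

Lemma central_cone_eta (C : symmonoidal) (T : strong_monad C) (X : C) :
  is_central_cone (eta T X).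
Proof. exact/central_coneP/central_eta. Qed.

Lemma central_cone_fmap (C : symmonoidal) (T : strong_monad C) (W X Y : C)
    (g : hom X Y) (f : hom W (T X)) :
  is_central_cone f -> is_central_cone (fmap T g ∘ f).
Proof.
move=> cf.
have -> : fmap T g = mu T Y ∘ fmap T (eta T Y ∘ g).
  by rewrite fmapD compA mu_Teta comp1f.
by apply: central_cone_kcomp cf; apply/central_cone_pre/central_cone_eta.
Qed.

(* The left and right strengths commute with each other. *)
Lemma tau_tau' (C : symmonoidal) (T : strong_monad C) (A X Y : C) :
  fmap T (assoc A X Y) ∘ (tau' T (A ⊗ X) Y ∘ (tau T A X ⊗₁ idm Y)) =
  tau T A (X ⊗ Y) ∘ ((idm A ⊗₁ tau' T X Y) ∘ assoc A (T X) Y).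
Proof.
have symK : tau T (A ⊗ Y) X =
    fmap T (symm Y A ⊗₁ idm X) ∘ (tau T (Y ⊗ A) X ∘ (symm A Y ⊗₁ idm (T X))).
  rewrite (rew22 _ (eq_sym (tau_nat T _ _))) fmap1 -tensmD symmK comp1f.
  by rewrite tensm1 compf1.
rewrite !tau'E !tensmDl -!compA symm_nat.
have tauA U V W R (k : hom R _) : tau T U (V ⊗ W) ∘ ((idm U ⊗₁ tau T V W) ∘ k) =
    fmap T (assoc U V W) ∘ (tau T (U ⊗ V) W ∘ (assocV _ _ _ ∘ k)).
  by rewrite (rew23 _ (tau_assoc T _ _ _)) (rew20 _ (assocVK _ _ _)).
rewrite tauA (rew22 _ (tau_nat T _ _)) tauA symK.
have -> : assocV Y A (T X) ∘ symm (A ⊗ T X) Y = (symm A Y ⊗₁ idm (T X)) ∘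
    (assocV A Y (T X) ∘ ((idm A ⊗₁ symm (T X) Y) ∘ assoc A (T X) Y)).
  have -> : assoc A (T X) Y = (idm A ⊗₁ symm Y (T X)) ∘ (assoc A Y (T X) ∘
      ((symm Y A ⊗₁ idm (T X)) ∘ (assocV Y A (T X) ∘ symm (A ⊗ T X) Y))).
    rewrite !compA -hexagon -!compA (rew20 _ (assocVK _ _ _)).
    by rewrite symmK compf1.
  rewrite (rew21 _ (eq_sym (tensmDl _ _ _))) symmK tensm1 comp1f.
  rewrite (rew20 _ (assocK _ _ _)).
  by rewrite (rew21 _ (eq_sym (tensmDr _ _ _))) symmK tensm1 comp1f.
rewrite -!compA !(rew21 _ (eq_sym (fmapD T _ _))) -!compA.
by rewrite (compA (assoc A X Y)) hexagon -!compA.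
Qed.

Lemma dst_tau (C : symmonoidal) (T : strong_monad C) (A X Y : C) :
  fmap T (assoc A X Y) ∘ (dst T (A ⊗ X) Y ∘ (tau T A X ⊗₁ idm (T Y))) =
  tau T A (X ⊗ Y) ∘ ((idm A ⊗₁ dst T X Y) ∘ assoc A (T X) (T Y)).
Proof.
rewrite /dst !tensmDl; rassoc.
rewrite -{1}(fmap1 T Y) tau_nat (rew22 _ (eq_sym (mu_nat T _))).
rewrite !(rew21 _ (eq_sym (fmapD T _ _))) -compA tau_tau' 2!fmapD; rassoc.
rewrite tau_assoc; rassoc; rewrite (rew22 _ (eq_sym (tau_nat T _ _))).
by rewrite (rew23 _ (tau_mu T _ _)).
Qed.

Lemma dst'_tau (C : symmonoidal) (T : strong_monad C) (A X Y : C) :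
  fmap T (assoc A X Y) ∘ (dst' T (A ⊗ X) Y ∘ (tau T A X ⊗₁ idm (T Y))) =
  tau T A (X ⊗ Y) ∘ ((idm A ⊗₁ dst' T X Y) ∘ assoc A (T X) (T Y)).
Proof.
rewrite /dst' 2!tensmDl; rassoc.
rewrite (rew22 _ (eq_sym (mu_nat T _))).
rewrite !(rew21 _ (eq_sym (fmapD T _ _))) tau_assoc 2!fmapD; rassoc.
rewrite tau_tau' (rew22 _ (eq_sym (tau_nat T _ _))).
by rewrite (rew23 _ (tau_mu T _ _)).
Qed.

Lemma central_cone_tau (C : symmonoidal) (T : strong_monad C) (A W X : C)
    (k : hom W (T X)) :
  is_central_cone k -> is_central_cone (tau T A X ∘ (idm A ⊗₁ k)).
Proof.
move=> ck Y.
have inj R (f g : hom R _) :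
    fmap T (assoc A X Y) ∘ f = fmap T (assoc A X Y) ∘ g -> f = g.
  move=> /(f_equal (fun h => fmap T (assocV A X Y) ∘ h)).
  by rewrite !compA -!fmapD assocK fmap1 !comp1f.
apply: inj; rewrite tensmDr.
rewrite (compA (dst T _ _)) (compA (dst' T _ _)).
rewrite (compA (fmap T _)) (compA (fmap T _) (dst' T _ _ ∘ _)) dst_tau dst'_tau.
by rassoc; rewrite assoc_nat !(rew21 _ (eq_sym (tensmDl _ _ _))) ck.
Qed.

(* Each structure map of the centre is the unique factorisation, through the
   terminal central cone, of the corresponding structure map of [T]. *)

Definition centre_fmap (C : symmonoidal) (T : strong_monad C)
    (Z : centralisable T) (X Y : C) (f : hom X Y) : hom (apex (Z X)) (apex (Z Y)) :=
  tcc_map (Z Y) (CentralCone (central_cone_fmap f (legP (Z X)))).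

Definition centre_eta (C : symmonoidal) (T : strong_monad C)
    (Z : centralisable T) (X : C) : hom X (apex (Z X)) :=
  tcc_map (Z X) (CentralCone (@central_cone_eta C T X)).

Definition centre_mu (C : symmonoidal) (T : strong_monad C)
    (Z : centralisable T) (X : C) : hom (apex (Z (apex (Z X)))) (apex (Z X)) :=
  tcc_map (Z X)
    (CentralCone (central_cone_kcomp (legP (Z X)) (legP (Z (apex (Z X)))))).

Definition centre_tau (C : symmonoidal) (T : strong_monad C)
    (Z : centralisable T) (X Y : C) : hom (X ⊗ apex (Z Y)) (apex (Z (X ⊗ Y))) :=
  tcc_map (Z (X ⊗ Y)) (CentralCone (central_cone_tau X (legP (Z Y)))).

Lemma centre_fmapE (C : symmonoidal) (T : strong_monad C)
    (Z : centralisable T) (X Y : C) (f : hom X Y) :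
  leg (Z Y) ∘ centre_fmap Z f = fmap T f ∘ leg (Z X).
Proof. exact (tcc_mapE (Z Y) (CentralCone (central_cone_fmap f (legP (Z X))))). Qed.

Lemma centre_etaE (C : symmonoidal) (T : strong_monad C)
    (Z : centralisable T) (X : C) : leg (Z X) ∘ centre_eta Z X = eta T X.
Proof. exact (tcc_mapE (Z X) (CentralCone (@central_cone_eta C T X))). Qed.

Lemma centre_muE (C : symmonoidal) (T : strong_monad C)
    (Z : centralisable T) (X : C) :
  leg (Z X) ∘ centre_mu Z X =
  mu T X ∘ fmap T (leg (Z X)) ∘ leg (Z (apex (Z X))).
Proof. exact (tcc_mapE (Z X)
  (CentralCone (central_cone_kcomp (legP (Z X)) (legP (Z (apex (Z X))))))). Qed.

Lemma centre_tauE (C : symmonoidal) (T : strong_monad C)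
    (Z : centralisable T) (X Y : C) :
  leg (Z (X ⊗ Y)) ∘ centre_tau Z X Y = tau T X Y ∘ (idm X ⊗₁ leg (Z Y)).
Proof. exact (tcc_mapE (Z (X ⊗ Y)) (CentralCone (central_cone_tau X (legP (Z Y))))). Qed.

Definition centre_functor (C : symmonoidal) (T : strong_monad C)
    (Z : centralisable T) : functor C C.
Proof.
refine {| fob := fun X => apex (Z X); fmap := @centre_fmap C T Z |}.
- by move=> X; apply: tcc_monic; rewrite centre_fmapE fmap1 comp1f compf1.
- move=> X Y V g f; apply: tcc_monic.
  by rewrite centre_fmapE compA centre_fmapE -compA centre_fmapE compA fmapD.
Defined.

Definition centre (C : symmonoidal) (T : strong_monad C) (Z : centralisable T) :
  strong_monad C.
Proof.
refine {| sm_fun := centre_functor Z;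
          eta := centre_eta Z;
          mu := centre_mu Z;
          tau := centre_tau Z |} => /=.
- move=> X Y f; apply: tcc_monic.
  rewrite (rew21 _ (centre_etaE _ _)) (rew22 _ (centre_fmapE _ _)).
  by rewrite centre_etaE eta_nat.
- move=> X Y f; apply: tcc_monic.
  rewrite (rew23 _ (centre_muE _ _)) centre_fmapE.
  rewrite (rew22 _ (centre_fmapE _ _)) centre_muE.
  rewrite !compA -(compA _ (fmap T _) (fmap T _)) -fmapD centre_fmapE fmapD.
  by rewrite compA mu_nat.
- move=> X; apply: tcc_monic.
  rewrite (rew23 _ (centre_muE _ _)) centre_etaE -eta_nat.
  by rewrite compA mu_etaT comp1f compf1.
- move=> X; apply: tcc_monic.
  rewrite (rew23 _ (centre_muE _ _)) centre_fmapE.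
  by rewrite !compA -(compA (mu T X)) -fmapD centre_etaE mu_Teta comp1f compf1.
- move=> X; apply: tcc_monic.
  rewrite !(rew23 _ (centre_muE _ _)) centre_muE centre_fmapE.
  rewrite (rew21 _ (eq_sym (fmapD T _ _))) centre_muE.
  rewrite !fmapD -!compA (rew22 _ (eq_sym (mu_nat T _))).
  by rewrite (rew22 _ (mu_mu T _)).
- move=> X X' Y Y' f g; apply: tcc_monic.
  rewrite (rew22 _ (centre_tauE _ _ _)) (rew22 _ (centre_fmapE _ _)) centre_tauE.
  rewrite -tensmD comp1f centre_fmapE (rew22 _ (eq_sym (tau_nat T _ _))).
  by rewrite -tensmD compf1.
- move=> X; apply: tcc_monic.
  rewrite (rew22 _ (centre_fmapE _ _)) centre_tauE.
  by rewrite (rew21 _ (tau_lunit T X)) lunit_nat.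
- move=> X Y V; apply: tcc_monic.
  rewrite (rew22 _ (centre_fmapE _ _)) centre_tauE -!compA.
  rewrite (rew22 _ (centre_tauE _ _ _)) (rew21 _ (eq_sym (tensmDl _ _ _))) centre_tauE.
  rewrite (rew23 _ (tau_assoc T X Y V)) -tensm1 assoc_nat tensmDl.
  by rewrite -!compA.
- move=> X Y; apply: tcc_monic.
  rewrite (rew22 _ (centre_tauE _ _ _)) -tensmDl !centre_etaE.
  exact: tau_eta.
- move=> X Y; apply: tcc_monic.
  rewrite (rew22 _ (centre_tauE _ _ _)) -tensmDl centre_muE.
  rewrite -!compA (rew23 _ (centre_muE _ _)) (rew22 _ (centre_fmapE _ _)) centre_tauE.
  rewrite (rew21 _ (eq_sym (fmapD T _ _))) centre_tauE !tensmDl.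
  rewrite (rew23 _ (tau_mu T _ _)) (rew22 _ (tau_nat T _ _)).
  by rewrite fmapD -!compA.
Defined.

Definition centre_incl (C : symmonoidal) (T : strong_monad C)
    (Z : centralisable T) : strong_monad_hom (centre Z) T :=
  {| smh := fun X => leg (Z X) : hom (centre Z X) (T X);
     smh_nat := @centre_fmapE C T Z;
     smh_eta := @centre_etaE C T Z;
     smh_mu := @centre_muE C T Z;
     smh_tau := @centre_tauE C T Z |}.

Lemma monic_components_submonad (C : symmonoidal) (S T : strong_monad C)
    (iota : strong_monad_hom S T) :
  (forall X, monic (iota X)) -> is_strong_submonad iota.
Proof.
move=> mi R f g fg; apply: strong_monad_hom_eq => X; apply: mi.
exact: (f_equal (fun h : strong_monad_hom R T => h X) fg).
Qed.

Lemma centre_incl_submonad (C : symmonoidal) (T : strong_monad C)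
    (Z : centralisable T) : is_strong_submonad (centre_incl Z).
Proof. by apply: monic_components_submonad => X; apply: tcc_monic. Qed.

(* Main.v *)
From Stdlib Require Import ssreflect ProofIrrelevance.
Require Import Defs.

Set Implicit Arguments.
Unset Strict Implicit.
Unset Printing Implicit Defensive.

Local Open Scope cat_scope.

(** A Kleisli morphism [f : X -> T Y] is central exactly when it is a central cone, and
    central cones are stable under precomposition. So [iota] being a central cone at every
    object says that every [iota ∘ f] is central, i.e. that the Kleisli functor lands in
    the centre; conversely [iota X] is the image of the identity of [S X], read as a
    Kleisli morphism [S X -> X]. A strong monad morphism intertwines the double strengths,
    so centrality of [iota] equates the two double strengths of [S] after composing with
    [iota]. Finally, terminality of the cones [leg (Z X)] factors a central [iota] through
    the centre, and [leg (Z X)] being monic makes the factorisation a strong monad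
    morphism. *)

(** Proof irrelevance identifies the laws, so convertible actions suffice for [corestricts_to]. *)
Lemma functor_eq (C D : category) (o : C -> D)
    (m : forall X Y, hom X Y -> hom (o X) (o Y)) i i' d d' :
  @Functor C D o m i d = @Functor C D o m i' d'.
Proof. by f_equal; apply: proof_irrelevance. Qed.

(** Faithfulness on Kleisli morphisms [W -> S X] is left cancellability of [iota X]. *)
Lemma is_embedding_monic (C : symmonoidal) (S T : strong_monad C)
    (iota : strong_monad_hom S T) :
  is_embedding (kleisli_functor iota) -> forall X, monic (iota X).
Proof. by move=> [_ inj] X W f g; apply: inj. Qed.

Lemma smh_tau' (C : symmonoidal) (S T : strong_monad C)
    (iota : strong_monad_hom S T) (X Y : C) :
  iota (X ⊗ Y) ∘ tau' S X Y = tau' T X Y ∘ (iota X ⊗₁ idm Y).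
Proof.
rewrite /tau'; rassoc; rewrite (rew22 _ (smh_nat iota _)).
by rewrite (rew22 _ (smh_tau iota _ _)) symm_nat.
Qed.

Lemma smh_dst (C : symmonoidal) (S T : strong_monad C)
    (iota : strong_monad_hom S T) (X Y : C) :
  iota (X ⊗ Y) ∘ dst S X Y = dst T X Y ∘ (iota X ⊗₁ iota Y).
Proof.
rewrite /dst; rassoc; rewrite (rew23 _ (smh_mu iota _)).
rewrite (rew22 _ (smh_nat iota _)) (smh_tau iota).
rewrite (rew21 _ (eq_sym (fmapD T _ _))) smh_tau' fmapD; rassoc.
by rewrite (rew22 _ (eq_sym (tau_nat T _ _))) fmap1 -tensmD comp1f compf1.
Qed.

Lemma smh_dst' (C : symmonoidal) (S T : strong_monad C)
    (iota : strong_monad_hom S T) (X Y : C) :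
  iota (X ⊗ Y) ∘ dst' S X Y = dst' T X Y ∘ (iota X ⊗₁ iota Y).
Proof.
rewrite /dst'; rassoc; rewrite (rew23 _ (smh_mu iota _)).
rewrite (rew22 _ (smh_nat iota _)) smh_tau'.
rewrite (rew21 _ (eq_sym (fmapD T _ _))) (smh_tau iota) fmapD; rassoc.
by rewrite (rew22 _ (eq_sym (tau'_nat T _ _))) fmap1 -tensmD comp1f compf1.
Qed.

Lemma central_submonad_commutative (C : symmonoidal) (S T : strong_monad C)
    (iota : strong_monad_hom S T) :
  (forall X, monic (iota X)) -> (forall X, is_central_cone (iota X)) ->
  commutative S.
Proof.
move=> mi ci X Y; apply: mi; rewrite smh_dst smh_dst'.
(* Splitting the tensor isolates [iota X] on the left, the form to which centrality applies. *)
have -> : iota X ⊗₁ iota Y = (iota X ⊗₁ idm (T Y)) ∘ (idm (S X) ⊗₁ iota Y).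
  by rewrite -tensmD comp1f compf1.
by rewrite !compA ci.
Qed.

Section Corestriction.

Variables (C : symmonoidal) (S T : strong_monad C) (iota : strong_monad_hom S T).
Hypothesis iota_central : forall X, is_central_cone (iota X).

Lemma central_postcomp (X Y : C) (f : hom X (S Y)) : central (iota Y ∘ f).
Proof. exact/central_coneP/central_cone_pre. Qed.

Definition corestriction : functor (kleisli S) (kleisli_centre T).
Proof.
refine {| fob := fun X : kleisli S => X : kleisli_centre T;
          fmap := fun (X Y : C) (f : hom X (S Y)) =>
            exist _ (iota Y ∘ f) (central_postcomp f) |}.
- by move=> X; apply: subset_eq_compat; apply: (fmap1 (kleisli_functor iota)).
- by move=> X Y Z g f; apply: subset_eq_compat;
    apply: (fmapD (kleisli_functor iota)).
Defined.

Lemma corestrictionP : corestricts_to iota corestriction.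
Proof. exact: functor_eq. Qed.

Lemma corestriction_embedding :
  is_embedding (kleisli_functor iota) -> is_embedding corestriction.
Proof.
by move=> [_ inj]; split=> // X Y f g /(f_equal (@proj1_sig _ _)); apply: inj.
Qed.

End Corestriction.

(* [Ihat] is the identity on objects only propositionally, so centrality is stated for
   all morphisms in the image of a functor before rewriting along [corestricts_to]. *)
Lemma corestricts_to_central (C : symmonoidal) (S T : strong_monad C)
    (iota : strong_monad_hom S T) (Ihat : functor (kleisli S) (kleisli_centre T)) :
  corestricts_to iota Ihat -> forall X, is_central_cone (iota X).
Proof.
move=> e X.
pose image_central (F : functor (kleisli S) (kleisli T)) :=
  forall (A B : kleisli S) (f : hom A B), @central C T (F A) (F B) (fmap F f).
have : image_central (kleisli_functor iota).
  by rewrite -e => A B f; apply: (proj2_sig (fmap Ihat f)).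
move=> /(_ (S X) X (idm (S X : C))) /=.
by rewrite compf1 => /central_coneP.
Qed.

Section FactorThroughCentre.

Variables (C : symmonoidal) (S T : strong_monad C) (iota : strong_monad_hom S T).
Hypothesis iota_central : forall X, is_central_cone (iota X).
Variable Z : centralisable T.

Definition centre_factor_map (X : C) : hom (S X) (centre Z X) :=
  tcc_map (Z X) (CentralCone (iota_central X)).

Lemma centre_factor_mapE (X : C) : leg (Z X) ∘ centre_factor_map X = iota X.
Proof. exact: (tcc_mapE (Z X) (CentralCone (iota_central X))). Qed.

Definition centre_factor : strong_monad_hom S (centre Z).
Proof.
exists centre_factor_map => /=.
- move=> X Y f; apply: tcc_monic.
  rewrite (rew21 _ (centre_factor_mapE _)) (rew22 _ (centre_fmapE _ _)).
  by rewrite centre_factor_mapE smh_nat.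
- move=> X; apply: tcc_monic.
  by rewrite (rew21 _ (centre_factor_mapE _)) centre_etaE smh_eta.
- move=> X; apply: tcc_monic.
  rewrite (rew21 _ (centre_factor_mapE _)); rassoc.
  rewrite (rew23 _ (centre_muE _ _)) (rew22 _ (centre_fmapE _ _)).
  rewrite (rew21 _ (eq_sym (fmapD T _ _))) !centre_factor_mapE.
  by rewrite smh_mu compA.
- move=> X Y; apply: tcc_monic.
  rewrite (rew21 _ (centre_factor_mapE _)) (rew22 _ (centre_tauE _ _ _)).
  by rewrite -tensmDl centre_factor_mapE smh_tau.
Defined.

Lemma centre_factorE : iota = strong_monad_comp (centre_incl Z) centre_factor.
Proof.
by apply: strong_monad_hom_eq => X; apply/eq_sym; apply: centre_factor_mapE.
Qed.

End FactorThroughCentre.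

Lemma monic_factor (C : category) (X Y Z : C) (g : hom Y Z) (f : hom X Y) :
  monic (g ∘ f) -> monic f.
Proof. by move=> mgf W h k e; apply: mgf; rewrite -!compA e. Qed.

(* The informal statement presupposes that the canonical functor
   [kleisli_functor iota] is an embedding; a monomorphism of strong monads over an
   arbitrary [C] does not guarantee it, so it is a premise of the parts using it. *)
Theorem theorem2p29 (C : symmonoidal) (T S : strong_monad C)
    (iota : strong_monad_hom S T) (iota_sub : is_strong_submonad iota) :
  (is_embedding (kleisli_functor iota) ->
    ((forall X : C, is_central_cone (iota X)) <->
      (exists Ihat : functor (kleisli S) (kleisli_centre T),
          corestricts_to iota Ihat /\ is_embedding Ihat)) /\
    ((forall X : C, is_central_cone (iota X)) -> commutative S)) /\
  ((forall X : C, is_central_cone (iota X)) <->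
    (exists Ihat : functor (kleisli S) (kleisli_centre T),
        corestricts_to iota Ihat)) /\
  (forall Z : centralisable T,
    (forall X : C, is_central_cone (iota X)) <->
    (exists j : strong_monad_hom S (centre Z),
        is_strong_submonad j /\ iota = strong_monad_comp (centre_incl Z) j)).
Proof.
split; [move=> emb; split; [split|]|split; [split|move=> Z; split]].
- move=> ci; exists (corestriction ci).
  by split; [apply: corestrictionP|apply: corestriction_embedding].
- by move=> [Ihat [cIhat _]]; apply: corestricts_to_central cIhat.
- exact/central_submonad_commutative/is_embedding_monic.
- by move=> ci; exists (corestriction ci); apply: corestrictionP.
- by move=> [Ihat cIhat]; apply: corestricts_to_central cIhat.
- move=> ci; have e := centre_factorE ci Z.
  exists (centre_factor ci Z); split=> //.
  (* The factor is monic because its composite with the centre inclusion is [iota]. *)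
  apply: (@monic_factor (StrMnd C) _ _ _ (centre_incl Z)).
  by rewrite /= -e.
(* Each [iota X] is a central leg precomposed with [j X]. *)
- by move=> [j [_ ->]] X; apply/central_cone_pre/legP.
Qed.
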